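(* For every positive integer $N\notin\{1,3\}$, the taxman game on $\{1,\dots,N\}$ can be won: there is a legal move sequence for which the player's final score is strictly greater than the taxman's final total, i.e., strictly greater than $N(N+1)/4$.
   Context: The taxman game on $\{1,\dots,N\}$: initially all integers $1,\dots,N$ are in play. A move consists of picking a number $p$ still in play that has at least one proper divisor still in play; the player adds $p$ to their score, $p$ is removed, and the taxman removes all proper divisors of $p$ still in play and adds them to the taxman's total. When no legal picks remain, the taxman adds all numbers still in play to the taxman's total. The player wins if their final score exceeds the taxman's final total. *)

(* Defs.v *)
From mathcomp Require Import all_boot.
Set Implicit Arguments. Unset Strict Implicit. Unset Printing Implicit Defensive.

(* A state of the taxman game is the list of numbers still in play. *)
Definition taxman_start (N : nat) : seq nat := iota 1 N.

Definition taxman_legal (S : seq nat) (p : nat) : bool :=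
  (p \in S) && has (fun d => (d %| p) && (d != p)) S.

Definition taxman_taken (S : seq nat) (p : nat) : seq nat :=
  [seq x <- S | (x %| p) && (x != p)].

Definition taxman_step (S : seq nat) (p : nat) : seq nat :=
  [seq x <- S | ~~ (x %| p)].

(* [taxman_game S ps] = Some (player score, taxman total) if ps is a legal
   sequence of picks from S after which no legal pick remains (the taxman then
   collects everything still in play); None otherwise. *)
Fixpoint taxman_game (S : seq nat) (ps : seq nat) : option (nat * nat) :=
  match ps with
  | [::] => if has (taxman_legal S) S then None else Some (0, sumn S)
  | p :: ps' =>
      if taxman_legal S p then
        match taxman_game (taxman_step S p) ps' with
        | Some (a, b) => Some (p + a, sumn (taxman_taken S p) + b)
        | None => None
        end
      else None
  end.

(* Main.v *)
(* If the pairs (p_1, d_1), ..., (p_k, d_k) are such that d_i is a proper divisor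
   of p_i and d_j divides no p_i with i < j, then picking p_1, ..., p_k is legal:
   at each step both p_j and d_j are still in play. Any legal sequence extends to
   a complete game, and the two totals add up to N(N+1)/2, so it is enough to
   find such pairs with sum of the p_i above N(N+1)/4. Seven explicit arithmetic
   families of pairs give a sum of about 0.2585 N^2, which suffices for N >= 600
   by bounding the floors and for smaller N by evaluation, apart from sixteen
   values of N that get their own list of picks. *)
Require Import Defs.
From Stdlib Require Import ZArith Lia.
From mathcomp Require Import all_boot zify.

(** * Legal pick sequences and complete games *)

Fixpoint taxman_picks (S ps : seq nat) : bool :=
  if ps is p :: ps' then taxman_legal S p && taxman_picks (taxman_step S p) ps'
  else true.

Lemma sumn_filter_predC (a : pred nat) (s : seq nat) :
  sumn s = sumn (filter a s) + sumn (filter (predC a) s).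
Proof. by elim: s => //= x s ->; case: (a x) => /=; lia. Qed.

Lemma taxman_step_sumn {S : seq nat} {p : nat} :
  uniq S -> p \in S ->
  sumn S = p + sumn (taxman_taken S p) + sumn (taxman_step S p).
Proof.
move=> uS pS; rewrite (sumn_filter_predC (fun x => x %| p) S).
rewrite (sumn_filter_predC (pred1 p) [seq x <- S | x %| p]) -!filter_predI.
congr (_ + _ + _); last by congr sumn; apply: eq_filter => x /=; rewrite andbC.
rewrite (@eq_filter _ _ (pred1 p)); last first.
  by move=> x /=; case: eqP => // ->; rewrite dvdnn.
by rewrite filter_pred1_uniq //= addn0.
Qed.

Lemma taxman_game_exists {S : seq nat} :
  uniq S ->
  exists ps a b, taxman_game S ps = Some (a, b) /\ a + b = sumn S.
Proof.
have [n] := ubnP (size S); elim: n S => // n IHn S ltSn uS.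
have [|noleg] := boolP (has (taxman_legal S) S); last first.
  by exists [::], 0, (sumn S); rewrite /= (negbTE noleg).
case/hasP => p pS legp.
have [||ps [a [b [game sum_ab]]]] := IHn (taxman_step S p).
(* As [p] divides itself, each pick strictly shrinks the list in play. *)
- rewrite size_filter -(count_predC (fun x => x %| p) S) in ltSn *.
  have: 0 < count (fun x => x %| p) S by rewrite -has_count; apply/hasP; exists p.
  have -> : count (fun x => ~~ (x %| p)) S = count (predC (fun x => x %| p)) S by [].
  lia.
- exact: filter_uniq.
exists (p :: ps), (p + a), (sumn (taxman_taken S p) + b).
by rewrite /= legp game (taxman_step_sumn uS pS) -sum_ab; split=> //; lia.
Qed.

Lemma taxman_game_extend {S ps : seq nat} :
  uniq S -> taxman_picks S ps ->
  exists qs a b,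
    [/\ taxman_game S qs = Some (a, b), a + b = sumn S & sumn ps <= a].
Proof.
elim: ps S => [|p ps IHps] S uS /=.
  by move=> _; have [qs [a [b [game ab]]]] := taxman_game_exists uS; exists qs, a, b.
case/andP => legp picks.
have [qs [a [b [game ab le_a]]]] := IHps _ (filter_uniq _ uS) picks.
exists (p :: qs), (p + a), (sumn (taxman_taken S p) + b); split.
- by rewrite /= legp game.
- by case/andP: legp => pS _; rewrite (taxman_step_sumn uS pS) -ab; lia.
- by rewrite leq_add2l.
Qed.

Lemma taxman_win {N : nat} {ps : seq nat} :
  taxman_picks (taxman_start N) ps -> N * (N + 1) < 4 * sumn ps ->
  exists qs player taxman,
    taxman_game (taxman_start N) qs = Some (player, taxman) /\
    taxman < player /\ N * (N + 1) < 4 * player.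
Proof.
move=> picks lt_ps.
have [qs [a [b [game ab le_a]]]] := taxman_game_extend (iota_uniq 1 N) picks.
exists qs, a, b; split=> //.
(* Given this total, [4 * a > N * (N + 1) = 2 * (a + b)] forces [b < a]. *)
suff: 2 * sumn (iota 1 N) = N * (N + 1) by rewrite -ab; lia.
elim: N {picks lt_ps game ab} => // n IHn.
by rewrite -(addn1 n) iotaD sumn_cat mulnDr IHn /=; lia.
Qed.

Lemma taxman_picks_of_pairs (S : seq nat) (ps : seq (nat * nat)) :
  all (fun x => [&& x.1 \in S, x.2 \in S, x.2 %| x.1 & x.2 != x.1]) ps ->
  pairwise (fun x y => ~~ (y.2 %| x.1)) ps ->
  taxman_picks S (map fst ps).
Proof.
elim: ps S => //= -[p d] ps IHps S /= /andP[/and4P[pS dS dvd ne] inS].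
case/andP => first rest; rewrite {1}/taxman_legal pS /=; apply/andP; split.
  by apply/hasP; exists d => //; rewrite dvd.
apply: IHps => //; apply/allP => -[q e] qe.
have /= /and4P[qS eS dvdq neq] := allP inS _ qe; have /= ndvd := allP first _ qe.
rewrite !mem_filter qS eS dvdq neq ndvd !andbT.
(* A later pick [q] survives too: if [q] divided [p], then so would its divisor [e]. *)
by apply: contra ndvd; apply: dvdn_trans.
Qed.

(** * Sums and legality of arithmetic families *)

(** An inequality rather than an equality, so that [hi < lo] is covered: the sum is then empty and
    [F] is nondecreasing. *)
Lemma sumn_telescope {f : nat -> nat} (F : nat -> Z) (lo hi : nat) :
  (forall i, F i.+1 = F i + Z.of_nat (f i))%Z ->
  (F hi <= F lo + Z.of_nat (sumn [seq f i | i <- index_iota lo hi]))%Z.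
Proof.
move=> dF; have leF i j : (F i <= F (i + j)%N)%Z.
  by elim: j => [|j IHj]; rewrite ?addn0 ?addnS ?dF; lia.
have [/subnKC <-|/ltnW/subnKC <-] := leqP lo hi; last first.
  by have := leF hi (lo - hi); lia.
rewrite /index_iota addKn; elim: (hi - lo) => [|n IHn]; first by rewrite addn0; lia.
rewrite -{2}(addn1 n) iotaD map_cat sumn_cat addnS dF /=; lia.
Qed.

(** Turns nondivisibility into finitely many linear disequalities, one for each possible
    quotient. *)
Lemma ndvdn_lt_mul (k d x : nat) :
  x < k * d -> (forall j, j < k -> x <> j * d) -> ~~ (d %| x).
Proof.
move=> ltx neq; apply/negP => /dvdnP[j ej]; apply: (neq j) => //.
by move: ltx; rewrite ej ltn_mul2r => /andP[].
Qed.

Definition pick_family (c : nat) (f : nat -> nat) (lo hi : nat) :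
    seq (nat * nat) :=
  [seq (c * f i, f i) | i <- index_iota lo hi].

(* The families are pairs (p, d) with p = c d and, in order,
     c = 2, d even,               N/16 < d <= N/8;
     c = 5, d coprime to 6,       N/10 < d <= N/5;
     c = 3, d odd multiple of 3,  N/6 < d <= N/5;
     c = 3, d odd,                N/5 < d <= N/3;
     c = 3, d = 2 mod 4,          N/6 < d <= 2N/9;
     c = 2, d even,               N/4 < d <= N/2;
     c = 2, d odd,                N/3 < d <= N/2.
   The i-th number coprime to 6 is 3i + 1 + i mod 2. *)
Definition picks (N : nat) : seq (nat * nat) :=
  pick_family 2 (fun i => 2 * i) (N %/ 32).+1 (N %/ 16).+1
  ++ pick_family 5 (fun i => 3 * i + 1 + i %% 2)
       ((N + 50) %/ 60 + (N + 10) %/ 60) ((N + 25) %/ 30 + (N + 5) %/ 30)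
  ++ pick_family 3 (fun i => 6 * i + 3) ((N + 18) %/ 36) ((N + 15) %/ 30)
  ++ pick_family 3 (fun i => 2 * i + 1) ((N + 5) %/ 10) ((N + 3) %/ 6)
  ++ pick_family 3 (fun i => 4 * i + 2) ((N + 12) %/ 24) ((N + 9) %/ 18)
  ++ pick_family 2 (fun i => 2 * i) (N %/ 8).+1 (N %/ 4).+1
  ++ pick_family 2 (fun i => 2 * i + 1) ((N + 3) %/ 6) ((N + 2) %/ 4).

Lemma pairwise_pick_family (c : nat) (f : nat -> nat) (lo hi : nat) :
  (forall i j, lo <= i < hi -> lo <= j < hi -> i < j -> ~~ (f j %| c * f i)) ->
  pairwise (fun x y => ~~ (y.2 %| x.1)) (pick_family c f lo hi).
Proof.
move=> ndvd; rewrite pairwise_map.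
apply: (@sub_in_pairwise _ (mem (index_iota lo hi)) ltn); last first.
- by rewrite -sorted_pairwise ?iota_ltn_sorted //; apply: ltn_trans.
- exact/allP.
by move=> i j; rewrite !mem_index_iota; apply: ndvd.
Qed.

Lemma allrel_pick_family (c c' : nat) (f f' : nat -> nat) (lo hi lo' hi' : nat) :
  (forall i j, lo <= i < hi -> lo' <= j < hi' -> ~~ (f' j %| c * f i)) ->
  allrel (fun x y => ~~ (y.2 %| x.1))
    (pick_family c f lo hi) (pick_family c' f' lo' hi').
Proof.
move=> ndvd; apply/allrelP => _ _ /mapP[i + ->] /mapP[j + ->].
by rewrite !mem_index_iota; apply: ndvd.
Qed.

Lemma picks_valid (N : nat) : taxman_picks (taxman_start N) (map fst (picks N)).
Proof.
apply: taxman_picks_of_pairs; rewrite /picks.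
  rewrite !all_cat; do !(apply/andP; split);
    apply/allP => _ /mapP[i + ->] /=; rewrite mem_index_iota => i_bd;
    by rewrite dvdn_mull // !mem_iota; lia.
rewrite !pairwise_cat !allrel_catr; do !(apply/andP; split) => //;
  try apply: allrel_pick_family; try apply: pairwise_pick_family.
(* Quotients stay below 10; the extreme case is the second family, with [p <= N] and [d > N/10].
   Each quotient is excluded by size or by residues modulo 3 or 4. *)
all: move=> i j bd_i bd_j; try move=> lt_ij; apply: (@ndvdn_lt_mul 10); first lia;
  do 10 (case=> [|k]; first lia; move: k); lia.
Qed.

(* The values of N for which [picks N] does not collect more than N(N+1)/4. *)
Definition small_picks : seq (nat * seq nat) :=
  [:: (11, [:: 11; 9; 6; 10]);
      (12, [:: 11; 9; 6; 12; 10]);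
      (13, [:: 13; 9; 6; 12; 10]);
      (15, [:: 13; 15; 10; 14; 8; 12]);
      (17, [:: 17; 15; 10; 14; 16; 12]);
      (18, [:: 17; 15; 10; 14; 16; 12; 18]);
      (19, [:: 19; 15; 10; 14; 16; 12; 18]);
      (20, [:: 19; 15; 10; 20; 16; 14; 12]);
      (21, [:: 19; 21; 14; 15; 20; 16; 12]);
      (23, [:: 23; 21; 14; 22; 15; 20; 16; 12]);
      (24, [:: 23; 21; 14; 22; 15; 20; 16; 24]);
      (25, [:: 23; 25; 15; 21; 14; 22; 20; 16; 24]);
      (41, [:: 41; 39; 26; 35; 33; 38; 27; 34; 18; 36; 24; 32; 28; 40]);
      (43, [:: 43; 39; 26; 35; 33; 38; 27; 34; 18; 36; 24; 32; 28; 42; 40]);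
      (61, [:: 61; 49; 55; 57; 38; 51; 58; 39; 46; 52; 44; 45; 50; 30; 60; 40;
       36; 54; 32; 48; 56]);
      (73, [:: 73; 65; 55; 69; 46; 49; 57; 51; 63; 62; 68; 45; 58; 52; 44; 66;
       42; 70; 50; 56; 40; 60; 36; 72; 48])].

Lemma small_picks_valid :
  all (fun e => taxman_picks (taxman_start e.1) e.2
                && (e.1 * (e.1 + 1) < 4 * sumn e.2)) small_picks.
Proof. by vm_compute. Qed.

(** * Closed form of the total *)

Local Open Scope Z_scope.

(** The telescoped family sums in the order of [picks], floors kept so that small cases can be
    evaluated. In the factor of 5, [u * (3 * u - 2)] and [v * (3 * v + 2)] sum the first [u] numbers
    1 mod 6 and the first [v] numbers 5 mod 6. *)
Definition pick_total (n : Z) : Z :=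
  2 * (n / 16 + 1) * (n / 16) - 2 * (n / 32 + 1) * (n / 32)
  + 5 * ((n + 25) / 30 * (3 * ((n + 25) / 30) - 2)
         + (n + 5) / 30 * (3 * ((n + 5) / 30) + 2)
         - (n + 50) / 60 * (3 * ((n + 50) / 60) - 2)
         - (n + 10) / 60 * (3 * ((n + 10) / 60) + 2))
  + 9 * (((n + 15) / 30) ^ 2 - ((n + 18) / 36) ^ 2)
  + 3 * (((n + 3) / 6) ^ 2 - ((n + 5) / 10) ^ 2)
  + 6 * (((n + 9) / 18) ^ 2 - ((n + 12) / 24) ^ 2)
  + 2 * (n / 4 + 1) * (n / 4) - 2 * (n / 8 + 1) * (n / 8)
  + 2 * (((n + 2) / 4) ^ 2 - ((n + 3) / 6) ^ 2).

Lemma Z_of_nat_divn (m d : nat) :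
  Z.of_nat (m %/ d) = Z.of_nat m / Z.of_nat d.
Proof.
case: d => [|d]; first by rewrite divn0 Zdiv_0_r.
apply: (Z.div_unique _ _ _ (Z.of_nat (m %% d.+1))); last first.
  by rewrite {1}(divn_eq m d.+1); lia.
by have := ltn_pmod m (ltn0Sn d); lia.
Qed.

Lemma picks_total (N : nat) :
  pick_total (Z.of_nat N) <= Z.of_nat (sumn (map fst (picks N))).
Proof.
have quad c (i : nat) : (c * Z.of_nat i.+1 ^ 2 =
    c * Z.of_nat i ^ 2 + c * (2 * Z.of_nat i + 1)) by lia.
have tri (lo hi : nat) :=
  @sumn_telescope (fun i => 2 * (2 * i))%N (fun n => 2 * Z.of_nat n * (Z.of_nat n - 1))
    lo hi ltac:(move=> i; cbv beta; lia).
(* Of the first [n] numbers coprime to 6, [n.+1 %/ 2] are 1 mod 6 and [n %/ 2] are 5 mod 6. *)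
have cop := @sumn_telescope (fun i => 5 * (3 * i + 1 + i %% 2))%N
  (fun n => 5 * (Z.of_nat (n.+1 %/ 2) * (3 * Z.of_nat (n.+1 %/ 2) - 2)
     + Z.of_nat (n %/ 2) * (3 * Z.of_nat (n %/ 2) + 2))).
have cop_step (i : nat) :
  5 * (Z.of_nat (i.+2 %/ 2) * (3 * Z.of_nat (i.+2 %/ 2) - 2)
     + Z.of_nat (i.+1 %/ 2) * (3 * Z.of_nat (i.+1 %/ 2) + 2)) =
  5 * (Z.of_nat (i.+1 %/ 2) * (3 * Z.of_nat (i.+1 %/ 2) - 2)
     + Z.of_nat (i %/ 2) * (3 * Z.of_nat (i %/ 2) + 2))
  + Z.of_nat (5 * (3 * i + 1 + i %% 2)).
  have -> : (i.+2 %/ 2 = (i %/ 2).+1)%N by lia.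
  have -> : (3 * i + 1 + i %% 2 = 4 * (i.+1 %/ 2) + 2 * (i %/ 2) + 1)%N by lia.
  by move: (i %/ 2) (i.+1 %/ 2) => u v; lia.
have sq9 lo hi := @sumn_telescope (fun i => 3 * (6 * i + 3))%N
  (fun n => 9 * Z.of_nat n ^ 2) lo hi ltac:(move=> i; cbv beta; rewrite quad; lia).
have sq3 lo hi := @sumn_telescope (fun i => 3 * (2 * i + 1))%N
  (fun n => 3 * Z.of_nat n ^ 2) lo hi ltac:(move=> i; cbv beta; rewrite quad; lia).
have sq6 lo hi := @sumn_telescope (fun i => 3 * (4 * i + 2))%N
  (fun n => 6 * Z.of_nat n ^ 2) lo hi ltac:(move=> i; cbv beta; rewrite quad; lia).
have sq2 lo hi := @sumn_telescope (fun i => 2 * (2 * i + 1))%N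
  (fun n => 2 * Z.of_nat n ^ 2) lo hi ltac:(move=> i; cbv beta; rewrite quad; lia).
rewrite /picks !map_cat !sumn_cat -!map_comp /comp /=.
move: (tri (N %/ 32).+1 (N %/ 16).+1) (tri (N %/ 8).+1 (N %/ 4).+1)
  (cop ((N + 50) %/ 60 + (N + 10) %/ 60)%N ((N + 25) %/ 30 + (N + 5) %/ 30)%N cop_step)
  (sq9 ((N + 18) %/ 36) ((N + 15) %/ 30)) (sq3 ((N + 5) %/ 10) ((N + 3) %/ 6))
  (sq6 ((N + 12) %/ 24) ((N + 9) %/ 18)) (sq2 ((N + 3) %/ 6) ((N + 2) %/ 4)).
clear tri cop cop_step sq9 sq3 sq6 sq2 quad.
(* The two residue counts differ by at most 1, so halving their sum, rounded up or down, recovers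
   each. *)
have -> : (((N + 25) %/ 30 + (N + 5) %/ 30).+1 %/ 2 = (N + 25) %/ 30)%N by lia.
have -> : (((N + 25) %/ 30 + (N + 5) %/ 30) %/ 2 = (N + 5) %/ 30)%N by lia.
have -> : (((N + 50) %/ 60 + (N + 10) %/ 60).+1 %/ 2 = (N + 50) %/ 60)%N by lia.
have -> : (((N + 50) %/ 60 + (N + 10) %/ 60) %/ 2 = (N + 10) %/ 60)%N by lia.
rewrite /pick_total !Nat2Z.inj_succ !Z_of_nat_divn !Nat2Z.inj_add.
do 7 (move: (sumn _) => ?).
lia.
Qed.

(** * Lower bound for large [n] *)

(** [c <= m + 1] makes the lower bound nonnegative, so squaring keeps the order. A floor and its
    square then act as separate unknowns with linear constraints. *)
Lemma sqr_div_bounds (m c : Z) : 0 < c -> c <= m + 1 ->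
  m - c + 1 <= c * (m / c) <= m /\
  (m - c + 1) ^ 2 <= c ^ 2 * (m / c) ^ 2 <= m ^ 2.
Proof.
move=> c_gt0 le_cm; rewrite -Z.pow_mul_l.
have [lo hi] : m - c + 1 <= c * (m / c) <= m.
  by have := Z.div_mod m c; have := Z.mod_pos_bound m c; lia.
by do !split=> //; apply: Z.pow_le_mono_l; lia.
Qed.

Lemma pick_total_large (n : Z) :
  600 <= n -> n * (n + 1) < 4 * pick_total n.
Proof.
move=> n_ge.
have bd m c := sqr_div_bounds (n + m) c.
have bd0 c := sqr_div_bounds n c.
(* Family by family, the [n ^ 2] coefficient is the one obtained by ignoring floors; the lower terms
   absorb the rounding. *)
have A1 : (3 * n ^ 2 - 88 * n - 60 <=
    512 * (2 * (n / 16 + 1) * (n / 16) - 2 * (n / 32 + 1) * (n / 32))).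
  move: (bd0 16 ltac:(lia) ltac:(lia)) (bd0 32 ltac:(lia) ltac:(lia)).
  by clear bd bd0; move: (n / 16) (n / 32); lia.
have E : (3 * n ^ 2 - 172 * n - 2456 <= 120 *
    (5 * ((n + 25) / 30 * (3 * ((n + 25) / 30) - 2)
         + (n + 5) / 30 * (3 * ((n + 5) / 30) + 2)
         - (n + 50) / 60 * (3 * ((n + 50) / 60) - 2)
         - (n + 10) / 60 * (3 * ((n + 10) / 60) + 2)))).
  move: (bd 25 30 ltac:(lia) ltac:(lia)) (bd 5 30 ltac:(lia) ltac:(lia))
    (bd 50 60 ltac:(lia) ltac:(lia)) (bd 10 60 ltac:(lia) ltac:(lia)).
  clear bd bd0 A1; move: ((n + 25) / 30) ((n + 5) / 30).
  by move: ((n + 50) / 60) ((n + 10) / 60); lia.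
have C1 : (11 * n ^ 2 - 1908 * n - 1044 <=
    3600 * (9 * (((n + 15) / 30) ^ 2 - ((n + 18) / 36) ^ 2))).
  move: (bd 15 30 ltac:(lia) ltac:(lia)) (bd 18 36 ltac:(lia) ltac:(lia)).
  by clear bd bd0 A1 E; move: ((n + 15) / 30) ((n + 18) / 36); lia.
have C : (16 * n ^ 2 - 190 * n - 125 <=
    300 * (3 * (((n + 3) / 6) ^ 2 - ((n + 5) / 10) ^ 2))).
  move: (bd 3 6 ltac:(lia) ltac:(lia)) (bd 5 10 ltac:(lia) ltac:(lia)).
  by clear bd bd0 A1 E C1; move: ((n + 3) / 6) ((n + 5) / 10); lia.
have G : (7 * n ^ 2 - 472 * n - 272 <=
    864 * (6 * (((n + 9) / 18) ^ 2 - ((n + 12) / 24) ^ 2))).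
  move: (bd 9 18 ltac:(lia) ltac:(lia)) (bd 12 24 ltac:(lia) ltac:(lia)).
  by clear bd bd0 A1 E C1 C; move: ((n + 9) / 18) ((n + 12) / 24); lia.
have A : (3 * n ^ 2 - 16 * n - 12 <=
    32 * (2 * (n / 4 + 1) * (n / 4) - 2 * (n / 8 + 1) * (n / 8))).
  move: (bd0 4 ltac:(lia) ltac:(lia)) (bd0 8 ltac:(lia) ltac:(lia)).
  by clear bd bd0 A1 E C1 C G; move: (n / 4) (n / 8); lia.
have B : (5 * n ^ 2 - 42 * n - 27 <=
    72 * (2 * (((n + 2) / 4) ^ 2 - ((n + 3) / 6) ^ 2))).
  move: (bd 2 4 ltac:(lia) ltac:(lia)) (bd 3 6 ltac:(lia) ltac:(lia)).
  by clear bd bd0 A1 E C1 C G A; move: ((n + 2) / 4) ((n + 3) / 6); lia.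
(* The seven bounds leave a surplus of about [0.034 n^2] against a loss of about [18.6 n + 90], so
   this linear bound on [n ^ 2] suffices. *)
have n2 : (600 * n <= n ^ 2) by clear -n_ge; nia.
move: A1 E C1 C G A B n2; rewrite /pick_total; clear -n_ge; lia.
Qed.

(** * Evaluation for small [N] and conclusion *)

Lemma pick_total_small :
  all (fun N => [|| N \in [:: 1; 3]%N, N \in map fst small_picks
      | Z.of_nat N * (Z.of_nat N + 1) <? 4 * pick_total (Z.of_nat N)])
    (iota 1 599).
Proof. by vm_compute. Qed.

Local Close Scope Z_scope.

Theorem theorem5 (N : nat) :
  0 < N -> N != 1 -> N != 3 ->
  exists (ps : seq nat) (player taxman : nat),
    taxman_game (taxman_start N) ps = Some (player, taxman) /\
    taxman < player /\ N * (N + 1) < 4 * player.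
Proof.
move=> N_gt0 N_neq1 N_neq3.
have [small|large] := boolP (N \in map fst small_picks).
  have [[M ps] in_small /= ->] := mapP small.
  by have /andP[] := allP small_picks_valid _ in_small; apply: taxman_win.
apply: (taxman_win (picks_valid N)).
suff : (Z.of_nat N * (Z.of_nat N + 1) < 4 * pick_total (Z.of_nat N))%Z.
  by have := picks_total N; lia.
have [N_lt|N_ge] := ltnP N 600; last by apply: pick_total_large; lia.
have N_in : N \in iota 1 599 by rewrite mem_iota; lia.
have /or3P[||/Z.ltb_lt //] := allP pick_total_small N N_in.
  by rewrite !inE (negbTE N_neq1) (negbTE N_neq3).
by rewrite (negbTE large).
Qed.
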